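(* For all integers $m \geqslant 1$, both graphs $\varDelta_m[-1]$ and $\varDelta_m[1]$ (the red and blue subgraphs of the edge-coloured graph $\varDelta_m$ defined in the context) are strongly regular, with parameters $v_m = 4^m$, $k_m = 2^{2m-1} - 2^{m-1}$, $\lambda_m = \mu_m = 2^{2m-2} - 2^{m-1}$.
   Context: Strongly regular graphs. A simple graph of order $v$ is strongly regular with parameters $(v,k,\lambda,\mu)$ if each vertex has degree $k$, each adjacent pair of vertices has $\lambda$ common neighbours, and each nonadjacent pair of (distinct) vertices has $\mu$ common neighbours. Canonical basis matrices. Let $\mathrm{E}_1 := \begin{pmatrix} 0 & -1 \\ 1 & 0 \end{pmatrix}$ and $\mathrm{E}_2 := \begin{pmatrix} 0 & 1 \\ 1 & 0 \end{pmatrix}$. Define $\gamma_1$ on $\mathbb{Z}_2^2$ (bit pairs) by $\gamma_1(00) = I$, $\gamma_1(01) = \mathrm{E}_1$, $\gamma_1(10) = \mathrm{E}_2$, $\gamma_1(11) = \mathrm{E}_1\mathrm{E}_2$. For $m > 1$, define $\gamma_m$ on $\mathbb{Z}_2^{2m}$ by $\gamma_m(p \odot i) := \gamma_1(p) \otimes \gamma_{m-1}(i)$ for $p \in \mathbb{Z}_2^2$, $i \in \mathbb{Z}_2^{2m-2}$, where $\odot$ denotes concatenation of bit vectors and $\otimes$ the Kronecker product. The $4^m$ matrices $\gamma_m(i)$, $i \in \mathbb{Z}_2^{2m}$, each of size $2^m \times 2^m$, are the canonical basis matrices of the real representation of the Clifford algebra $\mathbb{R}_{m,m}$. The graph $\varDelta_m$.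 $\varDelta_m$ is the graph whose vertices are these $4^m$ canonical basis matrices, with each edge having one of two colours, $-1$ (red) and $1$ (blue): matrices $A_j$ and $A_k$ are connected by a red edge if they have disjoint support (no position at which both have a nonzero entry) and $A_j A_k^{-1}$ is skew (skew-symmetric); they are connected by a blue edge if they have disjoint support and $A_j A_k^{-1}$ is symmetric; otherwise there is no edge between $A_j$ and $A_k$. The red subgraph $\varDelta_m[-1]$ has all the vertices of $\varDelta_m$ and all of its red edges; the blue subgraph $\varDelta_m[1]$ has all the vertices of $\varDelta_m$ and all of its blue edges. *)

(* Defs.v *)
From mathcomp Require Import all_boot all_order all_algebra.
From mathcomp Require Import mxtens.

Set Implicit Arguments.
Unset Strict Implicit.
Unset Printing Implicit Defensive.

Import GRing.Theory.
Local Open Scope ring_scope.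

Definition simple_graph (V : finType) (e : rel V) : Prop :=
  symmetric e /\ irreflexive e.

Definition common_neighbours (V : finType) (e : rel V) (x y : V) : {set V} :=
  [set z | e x z && e y z].

Definition strongly_regular (V : finType) (e : rel V) (v k l mu : nat) : Prop :=
  [/\ simple_graph e,
      #|V| = v,
      forall x : V, #|[set y | e x y]| = k,
      forall x y : V, e x y -> #|common_neighbours e x y| = l
    & forall x y : V, x != y -> ~~ e x y -> #|common_neighbours e x y| = mu].

Section CanonicalBasis.
Variable R : realFieldType.

Definition mx22 (a b c d : R) : 'M[R]_2 :=
  \matrix_(i < 2, j < 2)
    if i == 0 then (if j == 0 then a else b) else (if j == 0 then c else d).

Definition E1 : 'M[R]_2 := mx22 0 (- 1) 1 0.
Definition E2 : 'M[R]_2 := mx22 0 1 1 0.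

Definition gamma1 (p q : bool) : 'M[R]_2 :=
  match p, q with
  | false, false => 1%:M
  | false, true => E1
  | true, false => E2
  | true, true => E1 *m E2
  end.

(* Elements of Z_2^(2m) are bit tuples of length m.*2, leading bit first.  The
   case m = 0 is a filler (the 1 x 1 identity).  The recursion typechecks
   because m.+1.*2 and 2 ^ m.+2 are convertible to m.*2.+2 and 2 * 2 ^ m.+1;
   [*t] is the Kronecker product. *)
Fixpoint gamma (m : nat) : m.*2.-tuple bool -> 'M[R]_(2 ^ m) :=
  match m with
  | 0 => fun _ => 1%:M
  | n.+1 =>
    match n return (n.*2.-tuple bool -> 'M[R]_(2 ^ n)) ->
                   n.*2.+2.-tuple bool -> 'M[R]_(2 ^ n.+1) with
    | 0 => fun _ i => gamma1 (thead i) (thead [tuple of behead i])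
    | _.+1 => fun gamma_n i =>
        gamma1 (thead i) (thead [tuple of behead i])
          *t gamma_n [tuple of behead (behead i)]
    end (@gamma n)
  end.

(* The vertices are the matrices themselves, not their indices: that there are
   4 ^ m of them is part of the theorem. *)
Definition Delta_vertex (m : nat) : finType := seq_sub (codom (@gamma m)).

Definition Delta_mx (m : nat) (A : Delta_vertex m) : 'M[R]_(2 ^ m) := ssval A.

Definition disjoint_support (n : nat) (A B : 'M[R]_n) : bool :=
  [forall i, forall j, ~~ ((A i j != 0) && (B i j != 0))].

Definition symmetric_mx (n : nat) (A : 'M[R]_n) : bool := A^T == A.
Definition skew_mx (n : nat) (A : 'M[R]_n) : bool := A^T == - A.

End CanonicalBasis.

(* Red is the colour -1 and Blue is the colour 1. *)
Inductive colour := Red | Blue.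

(* [Delta R m c] is the adjacency relation of the subgraph of colour c. *)
Definition Delta (R : realFieldType) (m : nat) (c : colour) :
    rel (Delta_vertex R m) :=
  fun A B =>
    let: (Aj, Ak) := (Delta_mx A, Delta_mx B) in
    disjoint_support Aj Ak &&
    match c with
    | Red => skew_mx (Aj *m invmx Ak)
    | Blue => symmetric_mx (Aj *m invmx Ak)
    end.

(* Main.v *)
(** Up to sign, gamma(i) gamma(j)^-1 = gamma(i + j), so each colour class is a
    Cayley graph on Z_2^(2m) with a connection set D.  Let q(d) be the parity of
    the number of bit pairs 01 in d; gamma(d) is skew iff q(d) = 1, and it has
    no diagonal support iff some bit pair of d is 01 or 10.  Hence 1 - 2 [d in D]
    is (-1)^q in the red case and -(-1)^q + 2 [gamma(d) diagonal] in the blue one.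
    Both terms are products over the bit pairs, so their correlations factor:
    both functions have sum 2^m and are orthogonal to all their nontrivial
    translates.  This determines |D| and |D cap (D + d)| for d <> 0. *)

Require Import Defs.
From mathcomp Require Import all_boot all_order all_algebra.
From mathcomp Require Import mxtens ring zify.

Set Implicit Arguments.
Unset Strict Implicit.
Unset Printing Implicit Defensive.

Import Order.TTheory GRing.Theory Num.Theory.
Local Open Scope ring_scope.

(** * Bit vectors as an elementary abelian 2-group *)

Definition addt n (s t : n.-tuple bool) : n.-tuple bool :=
  [tuple of [seq p.1 (+) p.2 | p <- zip s t]].

Lemma tnth_addt n (s t : n.-tuple bool) i :
  tnth (addt s t) i = tnth s i (+) tnth t i.
Proof.
rewrite tnth_map (tnth_nth (false, false)) nth_zip ?size_tuple //=.
by rewrite !(tnth_nth false).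
Qed.

Lemma addt_cons n a b (s t : n.-tuple bool) :
  addt [tuple of a :: s] [tuple of b :: t] = [tuple of (a (+) b) :: addt s t].
Proof. exact: val_inj. Qed.

Lemma addtC n : commutative (@addt n).
Proof. by move=> s t; apply: eq_from_tnth => i; rewrite !tnth_addt addbC. Qed.

Lemma addtA n : associative (@addt n).
Proof. by move=> s t u; apply: eq_from_tnth => i; rewrite !tnth_addt addbA. Qed.

Lemma addtKl n (s t : n.-tuple bool) : addt s (addt s t) = t.
Proof. by apply: eq_from_tnth => i; rewrite !tnth_addt addbA addbb. Qed.

Lemma addtI n (s : n.-tuple bool) : injective (addt s).
Proof. exact: can_inj (addtKl s). Qed.

(** [has id] is the test for a nonzero vector; in characteristic 2 a sum vanishes only on equal
    arguments. *)
Lemma has_addt n (s t : n.-tuple bool) : has id (addt s t) = (s != t).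
Proof.
apply/idP/idP => [/(has_nthP false) [i] ilt|/eqP neq_st].
  rewrite size_tuple in ilt; rewrite -(tnth_nth _ _ (Ordinal ilt)) tnth_addt.
  by apply: contraL => /eqP ->; rewrite addbb.
apply/negPn/negP => /hasPn h; apply: neq_st; apply: eq_from_tnth => i.
have := h _ (mem_tnth i (addt s t)).
by rewrite tnth_addt; do 2!case: (tnth _ _).
Qed.

(** * Sums and correlations of products over bit pairs *)

Lemma big_tuple_cons n (F : n.+1.-tuple bool -> int) :
  \sum_t F t = \sum_b \sum_(t : n.-tuple bool) F [tuple of b :: t].
Proof.
rewrite pair_bigA /= (reindex (fun p : bool * n.-tuple bool =>
  [tuple of p.1 :: p.2])) //.
exists (fun t : n.+1.-tuple bool => (thead t, [tuple of behead t])).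
  by move=> [b t] _ /=; congr pair; apply: val_inj.
by move=> t _; rewrite -tuple_eta.
Qed.

(** Plain sequences avoid casts on lengths; a leftover single bit contributes the factor 1. *)
Fixpoint bitprod (g : bool -> bool -> int) (s : seq bool) : int :=
  if s is a :: b :: t then g a b * bitprod g t else 1.

Lemma eq_bitprod g h : (forall a b, g a b = h a b) -> bitprod g =1 bitprod h.
Proof.
(* Induction on a bound for the size, because the recursion consumes two entries at a time. *)
move=> eq_gh s; have [k] := ubnP (size s); elim: k s => // k IH [|a [|b t]] //=.
by move=> lt_t; rewrite eq_gh IH //; lia.
Qed.

(** Distributivity: the pairs vary independently, and each contributes the same local sum. *)
Lemma sum_bitprod m g :
  \sum_(t : m.*2.-tuple bool) bitprod g t = (\sum_a \sum_b g a b) ^+ m.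
Proof.
elim: m => [|m IH].
  by rewrite (big_pred1 [tuple]) // => t; rewrite (tuple0 t).
rewrite doubleS big_tuple_cons exprS -IH mulr_suml; apply: eq_bigr => a _.
rewrite big_tuple_cons mulr_suml; apply: eq_bigr => b _.
by rewrite mulr_sumr.
Qed.

(** Translation acts on each pair separately, so the sum factors into local correlations on
    Z_2^2. *)
Lemma correlation_bitprod m (g h : bool -> bool -> int) (c : m.*2.-tuple bool) :
  \sum_(t : m.*2.-tuple bool) bitprod g t * bitprod h (addt c t) =
  bitprod (fun a b => \sum_p \sum_q g p q * h (a (+) p) (b (+) q)) c.
Proof.
elim: m c => [|m IH] c.
  rewrite (big_pred1 [tuple]); last by move=> t; rewrite (tuple0 t).
  by rewrite (tuple0 c) mulr1.
rewrite doubleS in c *.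
case/tupleP: c => a c; case/tupleP: c => b c.
rewrite big_tuple_cons /= -IH mulr_suml; apply: eq_bigr => p _.
rewrite big_tuple_cons mulr_suml; apply: eq_bigr => q _.
rewrite mulr_sumr; apply: eq_bigr => t _ /=; ring.
Qed.

(* [skewness s] is the parity of the number of bit pairs 01, the only ones with
   a skew [gamma1]; [diagonal s] holds when all bit pairs are 00 or 11, the ones
   with a diagonal [gamma1]. *)
Fixpoint skewness (s : seq bool) : bool :=
  if s is a :: b :: t then (~~ a && b) (+) skewness t else false.

Fixpoint diagonal (s : seq bool) : bool :=
  if s is a :: b :: t then (a == b) && diagonal t else true.

Definition sgn_pair (a b : bool) : int := (-1) ^+ (~~ a && b).
Definition diag_pair (a b : bool) : int := (a == b)%:R.

Lemma bitprod_sgn s : bitprod sgn_pair s = (-1) ^+ skewness s.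
Proof.
have [k] := ubnP (size s); elim: k s => // k IH [|a [|b t]] //= lt_t.
by rewrite signr_addb IH //; lia.
Qed.

Lemma bitprod_diag s : bitprod diag_pair s = (diagonal s)%:R.
Proof.
have [k] := ubnP (size s); elim: k s => // k IH [|a [|b t]] //= lt_t.
by rewrite -mulnb natrM IH //; lia.
Qed.

Lemma diagonal_skewness s : diagonal s -> skewness s = false.
Proof.
have [k] := ubnP (size s); elim: k s => // k IH [|a [|b t]] //= lt_t.
by case/andP => /eqP -> /IH ->; [case: b | lia].
Qed.

Lemma hasN_diagonal s : ~~ has id s -> diagonal s.
Proof.
have [k] := ubnP (size s); elim: k s => // k IH [|a [|b t]] //= lt_t.
by rewrite !negb_or => /and3P [/negbTE -> /negbTE -> /IH ->] //; lia.
Qed.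

(** A nonzero vector has a nonzero pair, and the factor of that pair vanishes. *)
Lemma bitprod_eq0 m g (c : m.*2.-tuple bool) :
  (forall a b, a || b -> g a b = 0) -> has id c -> bitprod g c = 0.
Proof.
move=> g0; elim: m c => [|m IH] c; first by rewrite (tuple0 c).
rewrite doubleS in c *.
case/tupleP: c => a c; case/tupleP: c => b c /=.
rewrite orbA => /orP [/g0 ->|/IH ->]; [exact: mul0r | exact: mulr0].
Qed.

(** * Connection sets and their sign functions *)

Definition is_red (c : colour) : bool := if c is Red then true else false.

Definition connection (c : colour) (s : seq bool) : bool :=
  ~~ diagonal s && (skewness s == is_red c).

Definition connection_sign (c : colour) (s : seq bool) : int :=
  1 - (connection c s)%:R *+ 2.

(** Diagonal vectors have skewness 0 and lie outside both sets; in the blue case the second term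
    turns their value from -1 into 1. On all other vectors the skewness alone decides the colour. *)
Lemma connection_signE c s : connection_sign c s =
  if c is Red then bitprod sgn_pair s
  else - bitprod sgn_pair s + bitprod diag_pair s *+ 2.
Proof.
rewrite bitprod_sgn bitprod_diag /connection_sign /connection.
case: (boolP (diagonal s)) => [/diagonal_skewness ->|_]; first by case: c.
by case: c; case: (skewness s).
Qed.

(** Both local functions sum to 2 over the four pairs; the blue total is -2^m + 2 * 2^m. *)
Lemma sum_connection_sign c m :
  \sum_(t : m.*2.-tuple bool) connection_sign c t = 2 ^+ m.
Proof.
under eq_bigr => t _ do rewrite connection_signE.
have hs : \sum_(t : m.*2.-tuple bool) bitprod sgn_pair t = 2 ^+ m.
  by rewrite sum_bitprod !big_bool.
have hd : \sum_(t : m.*2.-tuple bool) bitprod diag_pair t = 2 ^+ m.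
  by rewrite sum_bitprod !big_bool.
case: c => //; rewrite big_split /= sumrN sumrMnl hs hd; ring.
Qed.

(* The sign functions are bent: distinct translates are orthogonal. *)
Lemma correlation_connection_sign c m (d : m.*2.-tuple bool) : has id d ->
  \sum_(t : m.*2.-tuple bool)
    connection_sign c t * connection_sign c (addt d t) = 0.
Proof.
move=> d_neq0.
(* [sgn_pair] is itself bent on Z_2^2: its local self-correlation vanishes at every nonzero pair. *)
have ss : \sum_(t : m.*2.-tuple bool)
    bitprod sgn_pair t * bitprod sgn_pair (addt d t) = 0.
  by rewrite correlation_bitprod bitprod_eq0 // => -[] []; rewrite ?big_bool.
(* All three correlations involving [diag_pair] equal this product, so in the blue case they cancel
   with coefficients -2, -2 and 4. *)
pose dd := bitprod (fun a b => (a == b)%:R *+ 2) d.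
have sd : \sum_(t : m.*2.-tuple bool)
    bitprod sgn_pair t * bitprod diag_pair (addt d t) = dd.
  rewrite correlation_bitprod; apply: eq_bitprod.
  by move=> [] []; rewrite !big_bool.
have ds : \sum_(t : m.*2.-tuple bool)
    bitprod diag_pair t * bitprod sgn_pair (addt d t) = dd.
  rewrite correlation_bitprod; apply: eq_bitprod.
  by move=> [] []; rewrite !big_bool.
have d2 : \sum_(t : m.*2.-tuple bool)
    bitprod diag_pair t * bitprod diag_pair (addt d t) = dd.
  rewrite correlation_bitprod; apply: eq_bitprod.
  by move=> [] []; rewrite !big_bool.
under eq_bigr => t _ do rewrite !connection_signE.
case: c => //.
rewrite (eq_bigr (fun t : m.*2.-tuple bool =>
  bitprod sgn_pair t * bitprod sgn_pair (addt d t)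
  - (bitprod sgn_pair t * bitprod diag_pair (addt d t)) *+ 2
  - (bitprod diag_pair t * bitprod sgn_pair (addt d t)) *+ 2
  + (bitprod diag_pair t * bitprod diag_pair (addt d t)) *+ 4)); last first.
  by move=> t _; ring.
by rewrite big_split !sumrB !sumrMnl /= ss sd ds d2; ring.
Qed.

Lemma sum_pred_card (T : finType) (P : pred T) :
  \sum_x (P x)%:R = #|[set x | P x]|%:R :> int.
Proof.
by rewrite -natr_sum -sum1dep_card [in RHS]big_mkcond.
Qed.

(** With M = m + 1, the sum of the signs reads 4^M - 2 |D| = 2^M. *)
Lemma card_connection c m :
  #|[set t : m.+1.*2.-tuple bool | connection c t]| =
  (2 ^ (2 * m.+1 - 1) - 2 ^ (m.+1 - 1))%N.
Proof.
have := sum_connection_sign c m.+1.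
rewrite sumrB sumrMnl sum_pred_card sumr_const card_tuple card_bool.
rewrite -natrX -mulrnA !natz => cardE.
have -> : (2 * m.+1 - 1 = m + m + 1)%N by lia.
move: cardE; rewrite subn1 -addnn addSn addnS !(expnS, expnD) expn0 /=.
set x := (2 ^ m)%N; set k := #|_| => cardE; nia.
Qed.

(** Expanding the vanishing correlation, with M = m + 1, gives 4^M - 4 |D| + 4 |D cap (D + d)| = 0,
    since D and its translate have the same size. *)
Lemma card_connection_translate c m (d : m.+1.*2.-tuple bool) : has id d ->
  #|[set t : m.+1.*2.-tuple bool | connection c t && connection c (addt d t)]| =
  (2 ^ (2 * m.+1 - 2) - 2 ^ (m.+1 - 1))%N.
Proof.
move=> /(correlation_connection_sign c).
pose D : pred (m.+1.*2.-tuple bool) := connection c.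
have -> : \sum_(t : m.+1.*2.-tuple bool)
    connection_sign c t * connection_sign c (addt d t) =
  \sum_t (1 - (D t)%:R *+ 2 - (D (addt d t))%:R *+ 2
          + (D t && D (addt d t))%:R *+ 4).
  apply: eq_bigr => t _; rewrite /connection_sign -!/(D _).
  by case: (D t); case: (D _).
rewrite big_split !sumrB !sumrMnl /=.
have <- : \sum_t (D t)%:R = \sum_t (D (addt d t))%:R :> int.
  by rewrite (reindex_inj (@addtI _ d)).
rewrite !sum_pred_card card_connection sumr_const card_tuple card_bool.
rewrite -!mulrnA !natz; change (fun t => _ && _) with
  (fun t : m.+1.*2.-tuple bool => D t && D (addt d t)).
move: #|_| => k.
have -> : (2 * m.+1 - 2 = m + m)%N by lia.
have -> : (2 * m.+1 - 1 = m + m + 1)%N by lia.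
rewrite subn1 -addnn addSn addnS !(expnS, expnD) expn0 /=.
(* From x >= 1 follows x <= x^2, so no natural-number subtraction truncates. *)
have : (0 < 2 ^ m)%N by rewrite expn_gt0.
set x := (2 ^ m)%N => x_gt0 cardE; nia.
Qed.

(** * Cayley graphs on Z_2^n *)

(** Translating one vertex to the origin turns the common neighbours of two distinct vertices into D
    cap (D + d), with d their nonzero difference; adjacency does not matter, hence lambda = mu. *)
Lemma strongly_regular_cayley n (V : finType) (e : rel V)
    (f : n.-tuple bool -> V) (D : pred (n.-tuple bool)) k l :
  bijective f -> (forall s t : n.-tuple bool, e (f s) (f t) = D (addt s t)) ->
  (forall t : n.-tuple bool, D t -> has id t) ->
  #|[set t | D t]| = k ->
  (forall d : n.-tuple bool, has id d ->
    #|[set t | D t && D (addt d t)]| = l) ->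
  strongly_regular e (2 ^ n) k l l.
Proof.
move=> fbij eE D0 cardD cardDD.
have f_inj := bij_inj fbij; have [g fK gK] := fbij.
have card_f (P : pred V) s : #|[set y | P y]| = #|[set t | P (f (addt s t))]|.
  rewrite -(on_card_preimset (f := f \o addt s)); last first.
    by apply: onW_bij; apply: bij_comp fbij (injF_bij (@addtI _ s)).
  by congr #|pred_of_set _|; apply/setP => t; rewrite !inE.
have common x y : x != y -> #|common_neighbours e x y| = l.
  rewrite -[x]gK -[y]gK (inj_eq f_inj) -has_addt addtC => /cardDD <-.
  rewrite /common_neighbours (card_f _ (g x)).
  by apply: eq_card => t; rewrite !inE !eE addtKl addtA.
have e_neq x y : e x y -> x != y.
  by rewrite -[x]gK -[y]gK (inj_eq f_inj) eE -has_addt => /D0.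
split.
- split=> [x y|x]; last by apply/negP => /e_neq; rewrite eqxx.
  by rewrite -[x]gK -[y]gK !eE addtC.
- by rewrite -(bij_eq_card fbij) card_tuple card_bool.
- move=> x; rewrite (card_f _ (g x)) -cardD; apply: eq_card => t.
  by rewrite !inE -[x in e x]gK eE addtKl.
- by move=> x y /e_neq /common.
- by move=> x y /common.
Qed.

(** * The two-by-two basis matrices *)

Section CanonicalBasisMatrices.
Variable R : realFieldType.
Implicit Types a b c d : bool.

Lemma mx22_1 : 1%:M = mx22 1 0 0 1 :> 'M[R]_2.
Proof. by apply/matrixP => -[[|[|//]] hi] [[|[|//]] hj]; rewrite !mxE. Qed.

Lemma mx22_mul (x y z t x' y' z' t' : R) :
  mx22 x y z t *m mx22 x' y' z' t' =
  mx22 (x * x' + y * z') (x * y' + y * t') (z * x' + t * z') (z * y' + t * t').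
Proof.
by apply/matrixP => -[[|[|//]] hi] [[|[|//]] hj];
  rewrite !mxE !big_ord_recl big_ord0 !mxE /= addr0.
Qed.

Lemma mx22_tr (x y z t : R) : (mx22 x y z t)^T = mx22 x z y t.
Proof. by apply/matrixP => -[[|[|//]] hi] [[|[|//]] hj]; rewrite !mxE. Qed.

Lemma mx22_scale (k x y z t : R) :
  k *: mx22 x y z t = mx22 (k * x) (k * y) (k * z) (k * t).
Proof. by apply/matrixP => -[[|[|//]] hi] [[|[|//]] hj]; rewrite !mxE. Qed.

Lemma gamma1E a b : gamma1 R a b =
  if a == b then mx22 ((-1) ^+ a) 0 0 1 else mx22 0 ((-1) ^+ b) 1 0.
Proof.
case: a b => [] [] //=; last exact: mx22_1.
by rewrite mx22_mul !(mulr0, mul0r, mulr1, mul1r, addr0, add0r).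
Qed.

Definition ringE := (mulr0, mul0r, mulr1, mul1r, addr0, add0r, mulrN1, mulN1r,
  @opprK R, @oppr0 R, expr0, expr1).

Lemma tr_gamma1 a b : (gamma1 R a b)^T = (-1) ^+ (~~ a && b) *: gamma1 R a b.
Proof.
by rewrite !gamma1E; case: a b => [] []; rewrite /= mx22_tr mx22_scale !ringE.
Qed.

Lemma gamma1_mul_tr a b : gamma1 R a b *m (gamma1 R a b)^T = 1%:M.
Proof.
rewrite !gamma1E mx22_1.
by case: a b => [] []; rewrite /= mx22_tr mx22_mul !ringE.
Qed.

(** The sign stays existential because neither symmetry nor skewness of a matrix depends on it. *)
Lemma gamma1_mul a b c d : exists s : bool,
  gamma1 R a b *m gamma1 R c d = (-1) ^+ s *: gamma1 R (a (+) c) (b (+) d).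
Proof.
rewrite !gamma1E; case: a b c d => [] [] [] [] /=;
  rewrite ?mx22_mul !ringE;
  (by exists false; rewrite mx22_scale !ringE) ||
  (by exists true; rewrite mx22_scale !ringE).
Qed.

Lemma tr_gamma1_mx a b : \tr (gamma1 R a b) = if a || b then 0 else 2.
Proof.
rewrite gamma1E /mxtrace !big_ord_recl big_ord0.
by case: a b => [] []; rewrite !mxE /= !ringE ?addrN ?addNr.
Qed.

Lemma disjoint_support_gamma1 a b c d :
  disjoint_support (gamma1 R a b) (gamma1 R c d) = ((a (+) c) != (b (+) d)).
Proof.
rewrite !gamma1E; apply/forallP/idP => [h|h].
  (* The first row decides, as each [gamma1] has exactly one nonzero entry there. *)
  have := h ord0 => /forallP h0; move: (h0 ord0) (h0 (lift ord0 ord0)).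
  by case: a b c d {h h0} => [] [] [] [];
    rewrite /= ?mxE /= ?oppr_eq0 ?oner_eq0 ?eqxx.
by move=> -[[|[|//]] hi]; apply/forallP => -[[|[|//]] hj];
  case: a b c d h => [] [] [] [] //=; rewrite !mxE /= ?eqxx ?andbF.
Qed.

(** * Kronecker products *)

Lemma tens1mx1 m n : 1%:M *t 1%:M = 1%:M :> 'M[R]_(m * n).
Proof.
apply/matrixP => i j; case: (mxtens_indexP i) => i1 i2.
case: (mxtens_indexP j) => j1 j2; rewrite tensmxE !mxE -natrM mulnb.
by rewrite (inj_eq (can_inj (@mxtens_indexK m n))).
Qed.

Lemma mxtrace_tens m n (A : 'M[R]_m) (B : 'M[R]_n) :
  \tr (A *t B) = \tr A * \tr B.
Proof. by rewrite /mxtrace mulr_sum; apply: eq_bigr => i _; rewrite mxE. Qed.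

Lemma tensZZ m n (x y : R) (A : 'M[R]_m) (B : 'M[R]_n) :
  (x *: A) *t (y *: B) = (x * y) *: (A *t B).
Proof. by apply/matrixP => i j; rewrite !mxE mulrACA. Qed.

(** The support of a Kronecker product is the product of the supports. *)
Lemma disjoint_support_tens m n (A C : 'M[R]_m) (B D : 'M[R]_n) :
  disjoint_support (A *t B) (C *t D) =
  disjoint_support A C || disjoint_support B D.
Proof.
apply/idP/idP => [/forallP h|].
  apply/orP; case: (boolP (disjoint_support A C)) => [|nAC]; [by left | right].
  case/forallPn: nAC => i /forallPn [j /negPn /andP [Aij Cij]].
  apply/forallP => k; apply/forallP => l.
  have /forallP /(_ (mxtens_index (j, l))) := h (mxtens_index (i, k)).
  by rewrite !tensmxE !mulf_eq0 !negb_or Aij Cij.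
move=> h; apply/forallP => i; apply/forallP => j.
rewrite !mxE !mulf_eq0 !negb_or.
case/orP: h => /forallP /(_ _) /forallP h.
  by move: (h (mxtens_unindex i).1 (mxtens_unindex j).1); do !case: (_ != 0).
by move: (h (mxtens_unindex i).2 (mxtens_unindex j).2); do !case: (_ != 0).
Qed.

(** * Canonical basis matrices of every order *)

(** The genuine recursion starts at m = 1, so the inductions below concern [m.+1] and take this as
    base case. *)
Lemma gamma_base a b (t : 0.-tuple bool) :
  @gamma R 1 [tuple of a :: [tuple of b :: t]] = gamma1 R a b.
Proof. by []. Qed.

Lemma gamma_tens m a b (t : m.+1.*2.-tuple bool) :
  @gamma R m.+2 [tuple of a :: [tuple of b :: t]] =
  gamma1 R a b *t gamma R t.
Proof.
(* The two tuples differ only in their proofs of length. *)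
apply: (congr1 (fun u => gamma1 R a b *t @gamma R m.+1 u)); exact: val_inj.
Qed.

Lemma tr_gamma m (i : m.+1.*2.-tuple bool) :
  (gamma R i)^T = (-1) ^+ skewness i *: gamma R i.
Proof.
elim: m i => [|m IH] i; case/tupleP: i => a i; case/tupleP: i => b i.
  by rewrite gamma_base tr_gamma1 (tuple0 i) /= addbF.
by rewrite gamma_tens trmx_tens tr_gamma1 IH tensZZ /= signr_addb.
Qed.

Lemma gamma_mul_tr m (i : m.+1.*2.-tuple bool) :
  gamma R i *m (gamma R i)^T = 1%:M.
Proof.
elim: m i => [|m IH] i; case/tupleP: i => a i; case/tupleP: i => b i.
  by rewrite gamma_base gamma1_mul_tr.
by rewrite gamma_tens trmx_tens tensmx_mul gamma1_mul_tr IH tens1mx1.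
Qed.

Lemma gamma_mul m (i j : m.+1.*2.-tuple bool) : exists s : bool,
  gamma R i *m gamma R j = (-1) ^+ s *: gamma R (addt i j).
Proof.
elim: m i j => [|m IH] i j; case/tupleP: i => a i; case/tupleP: i => b i;
  case/tupleP: j => c j; case/tupleP: j => d j; rewrite !addt_cons.
  by rewrite !gamma_base; apply: gamma1_mul.
have [s1 E1] := gamma1_mul a b c d; have [s2 E2] := IH i j.
by exists (s1 (+) s2); rewrite !gamma_tens tensmx_mul E1 E2 tensZZ signr_addb.
Qed.

Lemma mxtrace_gamma m (i : m.+1.*2.-tuple bool) :
  \tr (gamma R i) = if has id i then 0 else 2 ^+ m.+1.
Proof.
elim: m i => [|m IH] i; case/tupleP: i => a i; case/tupleP: i => b i.
  by rewrite gamma_base tr_gamma1_mx (tuple0 i) /= orbF expr1.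
rewrite gamma_tens mxtrace_tens tr_gamma1_mx IH /= orbA (exprS _ m.+1).
by case: (a || b); rewrite /= ?mul0r //; case: ifP; rewrite // mulr0.
Qed.

Lemma disjoint_support_gamma m (i j : m.+1.*2.-tuple bool) :
  disjoint_support (gamma R i) (gamma R j) = ~~ diagonal (addt i j).
Proof.
elim: m i j => [|m IH] i j; case/tupleP: i => a i; case/tupleP: i => b i;
  case/tupleP: j => c j; case/tupleP: j => d j; rewrite !addt_cons.
  by rewrite !gamma_base disjoint_support_gamma1 (tuple0 i) (tuple0 j) /= andbT.
by rewrite !gamma_tens disjoint_support_tens disjoint_support_gamma1 IH
  /= negb_and.
Qed.

(** The matrices are orthogonal, so the inverse is the transpose, which is the matrix itself up to
    sign. *)
Lemma gamma_div m (i j : m.+1.*2.-tuple bool) : exists s : bool,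
  gamma R i *m invmx (gamma R j) = (-1) ^+ s *: gamma R (addt i j).
Proof.
have /mulmx1_unit [uj _] := gamma_mul_tr j.
have -> : invmx (gamma R j) = (gamma R j)^T.
  by rewrite -[LHS]mulmx1 -(gamma_mul_tr j) mulmxA mulVmx // mul1mx.
have [s sE] := gamma_mul i j; exists (skewness j (+) s).
by rewrite tr_gamma -scalemxAr sE scalerA signr_addb.
Qed.

(** This keeps symmetric and skew mutually exclusive. *)
Lemma gamma_neq0 m (i : m.+1.*2.-tuple bool) : gamma R i != 0.
Proof.
apply/eqP => i0; have /(congr1 mxtrace) /eqP := gamma_mul_tr i.
by rewrite i0 mul0mx mxtrace0 mxtrace1 eq_sym pnatr_eq0 expn_eq0.
Qed.

(** For equal matrices the quotient is the identity, of nonzero trace; for distinct indices it is,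
    up to sign, a basis matrix of trace 0. *)
Lemma gamma_inj m : injective (@gamma R m.+1).
Proof.
move=> i j eq_ij; apply/eqP; rewrite -[_ == _]negbK -has_addt.
apply/negP => neq.
have [s /(congr1 mxtrace) /eqP] := gamma_div i j.
have /mulmx1_unit [uj _] := gamma_mul_tr j.
by rewrite eq_ij mulmxV // mxtraceZ mxtrace_gamma neq mulr0 mxtrace1
  pnatr_eq0 expn_eq0.
Qed.

Lemma mx_eq_opp m n (A : 'M[R]_(m, n)) : (A == - A) = (A == 0).
Proof. by rewrite -addr_eq0 -mulr2n -scaler_nat scaler_eq0 pnatr_eq0. Qed.

Lemma skew_gamma m (i : m.+1.*2.-tuple bool) (s : bool) :
  skew_mx ((-1) ^+ s *: gamma R i) = skewness i.
Proof.
rewrite /skew_mx linearZ /= tr_gamma scalerA mulrC -scalerA.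
case: (skewness i); first by rewrite scaleN1r eqxx.
by rewrite scale1r mx_eq_opp scaler_eq0 signr_eq0 (negbTE (gamma_neq0 i)).
Qed.

Lemma symmetric_gamma m (i : m.+1.*2.-tuple bool) (s : bool) :
  symmetric_mx ((-1) ^+ s *: gamma R i) = ~~ skewness i.
Proof.
rewrite /symmetric_mx linearZ /= tr_gamma scalerA mulrC -scalerA.
case: (skewness i); last by rewrite scale1r eqxx.
by rewrite scaleN1r eq_sym mx_eq_opp scaler_eq0 signr_eq0
  (negbTE (gamma_neq0 i)).
Qed.

End CanonicalBasisMatrices.

(** * The coloured graphs as Cayley graphs *)

Definition gamma_vertex (R : realFieldType) m (i : m.*2.-tuple bool) :
  Delta_vertex R m := SeqSub (codom_f (@gamma R m) i).

Lemma gamma_vertex_bij (R : realFieldType) m : bijective (@gamma_vertex R m.+1).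
Proof.
exists (fun A : Delta_vertex R m.+1 => iinv (ssvalP A)) => [i|A].
  by apply: (@gamma_inj R); rewrite f_iinv.
by apply: val_inj; rewrite /= f_iinv.
Qed.

Lemma Delta_gamma_vertex (R : realFieldType) m c (i j : m.+1.*2.-tuple bool) :
  Delta c (gamma_vertex R i) (gamma_vertex R j) = connection c (addt i j).
Proof.
rewrite /Delta /Delta_mx /= disjoint_support_gamma /connection.
have [s ->] := gamma_div R i j.
by case: c; rewrite ?skew_gamma ?symmetric_gamma /=; case: (skewness _).
Qed.

Lemma strongly_regular_Delta (R : realFieldType) m c :
  strongly_regular (@Delta R m.+1 c) (4 ^ m.+1)
    (2 ^ (2 * m.+1 - 1) - 2 ^ (m.+1 - 1))
    (2 ^ (2 * m.+1 - 2) - 2 ^ (m.+1 - 1))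
    (2 ^ (2 * m.+1 - 2) - 2 ^ (m.+1 - 1)).
Proof.
have -> : (4 ^ m.+1 = 2 ^ m.+1.*2)%N by rewrite -mul2n expnM.
apply: (strongly_regular_cayley (D := fun t => connection c t)
  (gamma_vertex_bij R m) (Delta_gamma_vertex R c)).
(* The zero vector is diagonal, hence outside the connection set. *)
- move=> t /andP [+ _]; apply: contraR; exact: hasN_diagonal.
- exact: card_connection.
- exact: card_connection_translate.
Qed.

Local Close Scope ring_scope.

Theorem theorem5p2 (R : realFieldType) (m : nat) (hm : (1 <= m)%N) :
  strongly_regular (@Delta R m Red)
    (4 ^ m)
    (2 ^ (2 * m - 1) - 2 ^ (m - 1))
    (2 ^ (2 * m - 2) - 2 ^ (m - 1))
    (2 ^ (2 * m - 2) - 2 ^ (m - 1)) /\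
  strongly_regular (@Delta R m Blue)
    (4 ^ m)
    (2 ^ (2 * m - 1) - 2 ^ (m - 1))
    (2 ^ (2 * m - 2) - 2 ^ (m - 1))
    (2 ^ (2 * m - 2) - 2 ^ (m - 1)).
Proof. by case: m hm => // m _; split; apply: strongly_regular_Delta. Qed.
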